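(* Let $q\ge 1$ be an integer. For every real $\eta>0$ and every $D\in\mathbb{N}$ there exist an $n_0=n_0(\eta,q)$ (depending only on $\eta$ and $q$) and an $M=M(\eta,D,q)\in\mathbb{N}$ such that if $n\ge n_0$, $\pi$ is a $q$-unbalanced degree sequence of length $n-M$ with $\Delta(\pi)\le D$, and $G$ is a graph on $n$ vertices with minimum degree $\delta(G)\geq\frac{n}{q+1}+\eta n$, then $\pi$ can be embedded into $G$.
   Context: All graphs are finite and simple. A finite sequence of natural numbers $\pi=(d_1,\dots,d_k)$ is a degree sequence of length $k$ if there is a simple graph on $k$ vertices whose (not necessarily monotone) degree sequence is $\pi$; such a graph is said to realize $\pi$. $\Delta(\pi)$ denotes the largest value in $\pi$. A bipartite graph with vertex classes $S$ and $T$ is $q$-unbalanced if $q|S|\le|T|$. A degree sequence $\pi$ is $q$-unbalanced if it can be realized by a $q$-unbalanced bipartite graph. A degree sequence $\pi$ of length $k$ can be embedded into a graph $G$ on $n\ge k$ vertices if $G$ has a (not necessarily induced) subgraph $H$ on $k$ vertices whose degree sequence is $\pi$ up to ordering, i.e. some realization $H$ of $\pi$ is isomorphic to a subgraph of $G$. *)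

(* Defs.v *)
From mathcomp Require Import all_boot.

Set Implicit Arguments.
Unset Strict Implicit.
Unset Printing Implicit Defensive.

Record sgraph := SGraph {
  vertex :> finType;
  adj : rel vertex;
  adj_sym : symmetric adj;
  adj_irr : irreflexive adj }.

Definition deg (G : sgraph) (v : G) : nat := #|[set w : G | adj v w]|.

(* Every degree is less than #|G|, so the default value #|G| is attained only
   by the graph without vertices, whose minimum degree is thus 0. *)
Definition mindeg (G : sgraph) : nat := \big[minn/#|G|]_(v : G) deg v.

(* A degree sequence lists the degrees in an arbitrary order of the vertices;
   in particular G has exactly size pi vertices. *)
Definition realizes (G : sgraph) (pi : seq nat) : Prop :=
  perm_eq [seq deg v | v : G] pi.

Definition maxval (pi : seq nat) : nat := \max_(d <- pi) d.

(* A vertex class may be empty. *)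
Definition bipartite_classes (G : sgraph) (S T : {set G}) : Prop :=
  [/\ S :|: T = [set: G], [disjoint S & T] &
      forall x y : G, adj x y ->
        (x \in S /\ y \in T) \/ (x \in T /\ y \in S)].

Definition unbalanced_graph (q : nat) (G : sgraph) : Prop :=
  exists S T : {set G}, bipartite_classes S T /\ q * #|S| <= #|T|.

Definition unbalanced_seq (q : nat) (pi : seq nat) : Prop :=
  exists H : sgraph, realizes H pi /\ unbalanced_graph q H.

(* H is isomorphic to a not necessarily induced subgraph of G. *)
Definition iso_to_subgraph (H G : sgraph) : Prop :=
  exists f : H -> G, injective f /\ forall x y : H, adj x y -> adj (f x) (f y).

Definition embeds (pi : seq nat) (G : sgraph) : Prop :=
  exists H : sgraph, realizes H pi /\ iso_to_subgraph H G.

(* Main.v *)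
Require Import Defs.
From mathcomp Require Import all_boot all_order all_algebra reals boolp.
From mathcomp Require Import zify ring.

(** The embedding is organised around complete bipartite graphs of a fixed
    size, the tiles K_{s,qs}.

    Host graph. For every s, all but a bounded number of the vertices of G can
    be partitioned into tiles K_{s,qs} ([almost_perfect_tiling]). Suppose that
    some tiles are given and let U be the set of uncovered vertices. If U is
    dense it contains a tile. If U is sparse, the minimum degree makes it
    send, to some tile t, more than (1/(q+1) + eta') |t| |U| edges, where
    eta' > 0 depends on eta only. The
    neighbourhoods in t of the vertices of U take boundedly many values, so
    many vertices of U have the same neighbourhood in t, and it is larger than
    the small side of t. Then t can be broken up into tiles of a smaller scale
    which also cover some vertices of U ([tile_exchange]). Each round covers
    a fixed proportion of the vertices and divides the scale by a constant, so
    boundedly many rounds suffice, provided the first scale is large enough.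

    Degree sequence. Split the sequence into the degrees in the classes S and
    T. The pairs of sequences with equal sums and q |S| <= |T| form a finitely
    generated monoid ([balanced_decomposition], from Dickson's lemma), so a long
    sequence contains many copies of one of finitely many bounded pieces
    ([abundant_piece]). As q |S| <= |T| holds for the piece too, copies of it
    placed in both orientations fill a tile exactly ([two_orientations]).
    Sequences of bounded degree and with many edges are realizable
    by switching ([simple_pairing]), hence such copies have a simple
    realization inside the tile, whatever the realization that is given for the
    whole sequence. Filling one tile after the other exhausts the sequence up
    to a bounded rest, which is put into a large biclique kept aside
    ([packs_into_tiling]). Only when the sequence has few edges is its given
    realization used, and then its non-isolated vertices fit into one
    tile ([iso_few_edges]). *)

Set Implicit Arguments.
Unset Strict Implicit.
Unset Printing Implicit Defensive.

(** * Finite sets *)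

Lemma subset_of_card (T : finType) (X : {set T}) (k : nat) :
  k <= #|X| -> exists2 Y : {set T}, Y \subset X & #|Y| = k.
Proof.
move=> kX; exists [set x in take k (enum X)].
  by apply/subsetP=> x; rewrite inE => /mem_take; rewrite mem_enum.
have -> : #|[set x in take k (enum X)]| = #|take k (enum X)|.
  by apply: eq_card => x; rewrite inE.
rewrite (card_uniqP _) ?take_uniq ?enum_uniq // size_take -cardE.
by case: ltngtP kX.
Qed.

Lemma split_of_card (T : finType) (X : {set T}) (k l : nat) :
  #|X| = k + l ->
  exists Y Z : {set T}, [/\ X = Y :|: Z, [disjoint Y & Z], #|Y| = k & #|Z| = l].
Proof.
move=> cX; have [|Y YX cY] := @subset_of_card _ X k; first by lia.
exists Y, (X :\: Y); split=> //.
- by rewrite setUC -{1}(setID X Y) (setIidPr YX) setUC.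
- by rewrite -setI_eq0 setIDA (setIC Y) -setIDA setDv setI0.
- by rewrite cardsDS // cX cY; lia.
Qed.

Lemma cardU_disjoint (T : finType) (X Y : {set T}) :
  [disjoint X & Y] -> #|X :|: Y| = #|X| + #|Y|.
Proof. by rewrite -leq_card_setU => /eqP. Qed.

Lemma disjointUl (T : finType) (X Y Z : {set T}) :
  [disjoint X :|: Y & Z] = [disjoint X & Z] && [disjoint Y & Z].
Proof. by rewrite !disjoints_subset subUset. Qed.

Lemma disjointUr (T : finType) (X Y Z : {set T}) :
  [disjoint X & Y :|: Z] = [disjoint X & Y] && [disjoint X & Z].
Proof. by rewrite !(disjoint_sym X) disjointUl. Qed.

(** * Tilings by complete bipartite graphs *)

Section Tiling.
Variables (q : nat) (G : sgraph).
Implicit Types (A B U W X Y Z : {set G}).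

Definition degin (v : G) X := #|[set w in X | adj v w]|.

Definition complete_pair A B := forall a b : G, a \in A -> b \in B -> adj a b.

Lemma complete_pair_sym A B : complete_pair A B -> complete_pair B A.
Proof. by move=> AB a b aB bA; rewrite adj_sym; apply: AB. Qed.

Lemma complete_pairS A B A' B' :
  A' \subset A -> B' \subset B -> complete_pair A B -> complete_pair A' B'.
Proof.
by move=> /subsetP sA /subsetP sB AB a b /sA aA /sB bB; apply: AB.
Qed.

Lemma complete_pair_disjoint A B : complete_pair A B -> [disjoint A & B].
Proof.
move=> AB; rewrite -setI_eq0; apply/eqP/setP=> x; rewrite !inE.
by apply/negP=> /andP[xA xB]; have := AB x x xA xB; rewrite adj_irr.
Qed.

Lemma sum_degin_sym U W : \sum_(u in U) degin u W = \sum_(w in W) degin w U.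
Proof.
have E V1 V2 : \sum_(u in V1) degin u V2 = \sum_(u in V1) \sum_(w in V2) adj u w.
  apply: eq_bigr => u _; rewrite /degin -sum1_card big_mkcond [RHS]big_mkcond /=.
  by apply: eq_bigr => w _; rewrite inE; case: (w \in V2); case: (adj u w).
rewrite !E exchange_big /=; apply: eq_bigr => w _; apply: eq_bigr => u _.
by rewrite adj_sym.
Qed.

Lemma leq_degin v X : degin v X <= #|X|.
Proof. by apply: subset_leq_card; apply/subsetP=> w; rewrite inE => /andP[]. Qed.

(** Sort the vertices of [U] by their neighbourhood in [W]; there are at most
    [2 ^ #|W|] classes. Classes with a small neighbourhood contribute at most
    [#|U| * k] to the sum, classes with fewer than [m] members at most
    [m * 2 ^ #|W| * #|W|], so some class has neither defect. For [W] of bounded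
    size this replaces both the Kovari-Sos-Turan theorem and the regularity
    lemma. *)
Lemma common_neighbourhood W U (k m : nat) :
  #|U| * k + m * 2 ^ #|W| * #|W| < \sum_(u in U) degin u W ->
  exists N U' : {set G}, [/\ N \subset W, U' \subset U, complete_pair N U',
    k <= #|N| & m <= #|U'|].
Proof.
move=> lt_sum; pose nb u := [set w in W | adj u w].
pose cl (N : {set G}) := [set u in U | nb u == N].
have [/existsP[N /and3P[NW kN mN]]|/existsPn noN] :=
  boolP [exists N : {set G}, [&& N \subset W, k <= #|N| & m <= #|cl N|]].
  exists N, (cl N); split=> //.
    by apply/subsetP=> u; rewrite inE => /andP[].
  by move=> w u wN; rewrite inE => /andP[_ /eqP nbu]; move: wN;
    rewrite -nbu inE adj_sym => /andP[].
suff: \sum_(u in U) degin u W <= #|U| * k + m * 2 ^ #|W| * #|W| by lia.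
rewrite (partition_big nb (mem (powerset W))) /=; last first.
  by move=> u _; rewrite powersetE; apply/subsetP=> w; rewrite inE => /andP[].
have {lt_sum} cU : \sum_(N in powerset W) #|cl N| <= #|U|.
  rewrite -[X in _ <= X]sum1_card (partition_big nb (mem (powerset W))) /=; last first.
    by move=> u _; rewrite powersetE; apply/subsetP=> w; rewrite inE => /andP[].
  apply: leq_sum => N _; rewrite -sum1_card (eq_bigl (fun u => (u \in U) && (nb u == N))) //.
  by move=> u; rewrite inE.
apply: (@leq_trans (\sum_(N in powerset W) (#|cl N| * k + m * #|W|))); last first.
  rewrite big_split /= -big_distrl /= sum_nat_const card_powerset.
  by apply: leq_add; rewrite ?leq_mul2r ?cU ?orbT //; lia.
apply: leq_sum => N; rewrite powersetE => NW.
rewrite (eq_bigr (fun=> #|N|)); last by move=> u /andP[_ /eqP <-].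
rewrite sum_nat_cond_const.
rewrite -/(cl N).
have := noN N; rewrite NW /= negb_and -!ltnNge => /orP[lt|lt].
  by apply: (leq_trans _ (leq_addr _ _)); rewrite leq_mul2l ltnW ?orbT.
apply: (leq_trans _ (leq_addl _ _)); apply: leq_mul; first exact: ltnW.
exact: subset_leq_card.
Qed.

(** Partitions of a set into copies of K_{s,qs}, as an inductive family rather
    than a set of tiles: tilings are only joined, refined and deprived of a tile,
    and all of this goes by induction. *)
Inductive tiled (s : nat) : {set G} -> Prop :=
| tiled0 : tiled s set0
| tiledU A B X : #|A| = s -> #|B| = q * s -> complete_pair A B ->
    [disjoint A :|: B & X] -> tiled s X -> tiled s (A :|: B :|: X).

Lemma tiled_union s X Y :
  tiled s X -> tiled s Y -> [disjoint X & Y] -> tiled s (X :|: Y).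
Proof.
move=> tX; elim: tX Y => [|A B {}X cA cB AB dX tX IH] Y tY.
  by rewrite set0U.
rewrite disjointUl => /andP[d1 d2].
rewrite -setUA; apply: tiledU => //; last exact: IH.
by rewrite disjointUr dX.
Qed.

Lemma tiled_tile s A B :
  #|A| = s -> #|B| = q * s -> complete_pair A B -> tiled s (A :|: B).
Proof.
move=> cA cB AB; rewrite -[_ :|: _]setU0; apply: tiledU => //; last exact: tiled0.
by rewrite -setI_eq0 setI0.
Qed.

Lemma disjointUU A1 A2 B1 B2 : [disjoint A1 & A2] -> [disjoint B1 & B2] ->
  [disjoint A1 :|: A2 & B1 :|: B2] -> [disjoint A1 :|: B1 & A2 :|: B2].
Proof.
rewrite -!setI_eq0 !setIUl !setIUr !setU_eq0 => /eqP-> /eqP->; rewrite eqxx /=.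
by case/and3P=> /andP[_ ->] /=; rewrite (setIC B1) => /eqP->; rewrite eqxx.
Qed.

(** Use [i] tiles with their small side in [A] and [j] tiles with their small
    side in [B]. *)
Lemma tiled_biclique s i j A B :
  #|A| = (i + q * j) * s -> #|B| = (q * i + j) * s -> complete_pair A B ->
  tiled s (A :|: B).
Proof.
elim: i A B => [|i IH] A B.
  elim: j A B => [|j IH] A B cA cB AB.
    have [-> ->] : A = set0 /\ B = set0.
      by split; apply/eqP; rewrite -cards_eq0 ?cA ?cB; lia.
    by rewrite setU0; apply: tiled0.
  have [|A1 [A2 [EA dA cA1 cA2]]] := @split_of_card _ A (q * s) (q * j * s).
    by rewrite cA; nia.
  have [|B1 [B2 [EB dB cB1 cB2]]] := @split_of_card _ B s (j * s).
    by rewrite cB; nia.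
  have dAB := complete_pair_disjoint AB.
  rewrite {}EA {}EB in AB dAB *.
  rewrite setUACA; apply: tiled_union.
  - rewrite setUC; apply: tiled_tile => //; apply: complete_pair_sym.
    by apply: complete_pairS AB; rewrite subsetUl.
  - apply: IH; first by rewrite cA2 add0n.
      by rewrite cB2; nia.
    by apply: complete_pairS AB; rewrite subsetUr.
  - exact: disjointUU.
move=> cA cB AB.
have [|A1 [A2 [EA dA cA1 cA2]]] := @split_of_card _ A s ((i + q * j) * s).
  by rewrite cA; nia.
have [|B1 [B2 [EB dB cB1 cB2]]] := @split_of_card _ B (q * s) ((q * i + j) * s).
  by rewrite cB; nia.
have dAB := complete_pair_disjoint AB.
rewrite {}EA {}EB in AB dAB *.
rewrite setUACA; apply: tiled_union.
- by apply: tiled_tile => //; apply: complete_pairS AB; rewrite subsetUl.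
- by apply: IH => //; apply: complete_pairS AB; rewrite subsetUr.
- exact: disjointUU.
Qed.

Lemma tiled_refine s c X : tiled (c * s) X -> tiled s X.
Proof.
elim=> [|A B {}X cA cB AB dX _ tX]; first exact: tiled0.
apply: tiled_union => //; apply: (@tiled_biclique s c 0) AB; lia.
Qed.

(** Averaging: if the mean of [f] over [X] exceeds [c / d], so does its mean
    over some tile, and that tile can be split off. *)
Lemma tiled_heavy_tile s X (f : G -> nat) (c d : nat) :
  tiled s X -> c * #|X| < d * \sum_(x in X) f x ->
  exists A B X', [/\ X = A :|: B :|: X', #|A| = s /\ #|B| = q * s,
    complete_pair A B /\ [disjoint A :|: B & X'], tiled s X' &
    c * #|A :|: B| < d * \sum_(x in A :|: B) f x].
Proof.
elim=> [|A B {}X cA cB AB dX tX IH]; first by rewrite big_set0; lia.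
have [lt _|le] := ltnP (c * #|A :|: B|) (d * \sum_(x in A :|: B) f x).
  by exists A, B, X.
rewrite cardU_disjoint // (big_setID (A :|: B)) /=.
rewrite setIUl setIid (setIC X) (disjoint_setI0 dX) setU0.
rewrite setDUl setDv set0U.
have -> : X :\: (A :|: B) = X.
  by apply/setDidPl; rewrite disjoint_sym.
rewrite !mulnDr => lt.
have [|A' [B' [X' [EX cA' [AB' dX'] tX' lt']]]] := IH; first by lia.
rewrite {X tX IH lt le}EX in dX *.
exists A', B', (A :|: B :|: X'); split=> //.
- by rewrite setUCA.
- split=> //; rewrite disjointUr dX' andbT disjoint_sym.
  by move: dX; rewrite disjointUr => /andP[].
- by apply: tiledU => //; move: dX; rewrite disjointUr => /andP[].
Qed.

Hypothesis q_gt0 : 0 < q.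

(** How a tile of the coarse scale absorbs uncovered vertices. The set [N] is
    larger than the small side [A] by [q ^ 2 * s], hence meets [B] (and, when [q = 1],
    also [A]) in many vertices. Remove [k1 * s] vertices of [N] from [A] and
    [k2 * s] from [B], and use them as the small sides of new tiles whose large
    sides come from [U]. What is left of the coarse tile still splits into
    [i] tiles of one orientation and [j] of the other exactly when
    [k2 = q * k1 + (q ^ 2 - 1) * j]. For [q = 1] the choice is [k1 = k2 = 1];
    for [q >= 2], where [N] may miss [A] altogether, it is [k1 = 0], [j = 1]. *)
Lemma tile_exchange s C A B (N U : {set G}) :
  q ^ 2 <= C -> #|A| = C * s -> #|B| = q * (C * s) -> complete_pair A B ->
  N \subset A :|: B -> [disjoint A :|: B & U] -> complete_pair N U ->
  C * s + q ^ 2 * s <= #|N| -> 2 * q ^ 3 * s <= #|U| ->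
  exists V : {set G}, [/\ V \subset U, s <= #|V| & tiled s (A :|: B :|: V)].
Proof.
move=> qC cA cB AB NAB dU NU cN cU.
have cNAB : #|N| <= #|N :&: A| + #|N :&: B|.
  by rewrite -{1}(setIidPl NAB) setIUr leq_card_setU.
have cNA : #|N :&: A| <= #|A| by rewrite subset_leq_card ?subsetIr.
have cNB : #|N :&: B| <= #|B| by rewrite subset_leq_card ?subsetIr.
have [k1 [k2 [i [j [Ei Ej k1N k2N k_bnd]]]]] : exists k1 k2 i j,
    [/\ i + q * j + k1 = C, q * i + j + k2 = q * C,
        k1 * s <= #|N :&: A|, k2 * s <= #|N :&: B| & 0 < k1 + k2 <= 2 * q ^ 2].
  have [q1|q1] := eqVneq q 1.
    move: cB qC cN; rewrite q1 => cB qC cN.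
    by exists 1, 1, C.-1, 0; split; lia.
  have q2 : 1 < q by lia.
  by exists 0, (q ^ 2 - 1), (C - q), 1; split; nia.
have [N1 N1N cN1] := subset_of_card k1N.
have [N2 N2N cN2] := subset_of_card k2N.
have [V VU cV] : exists2 V : {set G}, V \subset U & #|V| = q * ((k1 + k2) * s).
  apply: subset_of_card; apply: leq_trans cU.
  have -> : 2 * q ^ 3 * s = q * (2 * q ^ 2 * s) by nia.
  by rewrite leq_mul2l leq_mul2r; lia.
move: N1N N2N; rewrite !subsetI => /andP[N1N N1A] /andP[N2N N2B].
exists V; split=> //.
  by rewrite cV -[X in X <= _]mul1n mulnA leq_mul2r; apply/orP; right; nia.
have dV : [disjoint A :|: B & V] by rewrite disjoint_sym (disjointWl VU) // disjoint_sym.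
have dN : [disjoint N1 & N2].
  by apply: disjointW (complete_pair_disjoint AB).
have cD1 : #|A :\: N1| = (i + q * j) * s 
  by rewrite cardsDS // cA cN1 -Ei mulnDl addnK.
have cD2 : #|B :\: N2| = (q * i + j) * s 
  by rewrite cardsDS // cB cN2 mulnA -Ej mulnDl addnK.
have t1 : tiled s ((A :\: N1) :|: (B :\: N2)).
  by apply: tiled_biclique cD1 cD2 _; apply: complete_pairS AB; rewrite subsetDl.
have t2 : tiled s (N1 :|: N2 :|: V).
  apply: (@tiled_biclique s (k1 + k2) 0); rewrite ?muln0 ?addn0.
  - by rewrite cardU_disjoint // cN1 cN2 mulnDl.
  - by rewrite cV mulnA.
  - by apply: complete_pairS NU; rewrite // subUset N1N.
have -> : A :|: B :|: V = (A :\: N1) :|: (B :\: N2) :|: (N1 :|: N2 :|: V).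
  rewrite setUA setUACA; congr (_ :|: _ :|: _).
    by rewrite setUC -{1}(setID A N1) (setIidPr N1A).
  by rewrite setUC -{1}(setID B N2) (setIidPr N2B).
apply: tiled_union => //.
move: dV; rewrite !disjointUr !disjointUl => /andP[dA dB].
have -> : [disjoint A :\: N1 & V] by apply: disjointWl dA; rewrite subsetDl.
have -> : [disjoint B :\: N2 & V] by apply: disjointWl dB; rewrite subsetDl.
have dAB := complete_pair_disjoint AB.
have -> : [disjoint A :\: N1 & N2] by apply: disjointW dAB; rewrite ?subsetDl.
have -> : [disjoint B :\: N2 & N1].
  by rewrite disjoint_sym; apply: disjointW dAB; rewrite ?subsetDl.
by rewrite !disjoints_subset !setDE !subsetIr.
Qed.

(** Either [16 E s] vertices of [U] have at least [#|U| / (8 E)] neighbours in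
    [U], and they contain the small side of a tile by [common_neighbourhood], or the
    few exceptional vertices are negligible and [U] spans few edges. *)
Lemma dense_tile s E U : 0 < s -> 0 < E ->
  q * 2 ^ (16 * E * s) * (16 * E * s) < #|U| -> 8 * E * (16 * E * s) <= #|U| ->
  (exists A B : {set G}, [/\ A \subset U, B \subset U, #|A| = s, #|B| = q * s & complete_pair A B])
  \/ 4 * E * (\sum_(u in U) degin u U) <= #|U| * #|U|.
Proof.
move=> s0 E0; set w := 16 * E * s => big1 big2.
pose H := [set u in U | #|U| < 8 * E * degin u U].
have [wH|Hw] := leqP w #|H|.
  have [W WH cW] := subset_of_card wH; left.
  have [|N [U' [NW U'U NU' cN cU']]] := @common_neighbourhood W U s (q * s).
    rewrite sum_degin_sym cW.
    have : w * #|U|.+1 <= 8 * E * \sum_(u in W) degin u U.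
      rewrite -cW big_distrr /= -sum_nat_const; apply: leq_sum => u /(subsetP WH).
      by rewrite inE => /andP[].
    have : #|U| * s + q * s * 2 ^ w * w < 2 * #|U| * s by nia.
    rewrite /w; nia.
  have [A AN cA] := subset_of_card cN.
  have [B BU cB] := subset_of_card cU'.
  exists A, B; split=> //; last by apply: complete_pairS NU'.
    apply: subset_trans AN (subset_trans NW (subset_trans WH _)).
    by apply/subsetP=> u; rewrite inE => /andP[].
  exact: subset_trans U'U.
right.
rewrite (bigID (mem H)) /= mulnDr.
have le1 : \sum_(u in U | u \in H) degin u U <= w * #|U|.
  apply: (@leq_trans (\sum_(u in H) #|U|)).
    rewrite (eq_bigl (mem H)); last first.
      by move=> u; rewrite /= inE; case: (u \in U).
    by apply: leq_sum => u _; apply: leq_degin.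
  by rewrite sum_nat_const leq_mul2r ltnW ?orbT.
have le2 : 8 * E * \sum_(u in U | u \notin H) degin u U <= #|U| * #|U|.
  rewrite big_distrr /= -sum_nat_const big_mkcondr /=.
  apply: leq_sum => u uU; case: ifP => //.
  by rewrite inE uU /= -leqNgt.
nia.
Qed.

End Tiling.

(** * Almost perfect tilings *)

Lemma deg_degin_setT (G : sgraph) (v : G) : deg v = degin v [set: G].
Proof. by apply: eq_card => w; rewrite !inE. Qed.

Lemma degin_setU (G : sgraph) (v : G) (X Y : {set G}) :
  degin v (X :|: Y) <= degin v X + degin v Y.
Proof.
rewrite /degin (_ : [set _ in _ | _] = [set w in X | adj v w] :|: [set w in Y | adj v w]).
  exact: leq_card_setU.
by apply/setP=> w; rewrite !inE andb_orl.
Qed.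

(** Ratio between two consecutive scales of tiles. It is so large that a
    surplus of [1 / (4 E)] of the size of a coarse tile is at least twice the
    [q ^ 2 * s] vertices that [tile_exchange] asks for. *)
Definition coarse_factor E q := 8 * E * q ^ 2.

Lemma heavy_tile_neighbourhood q E s (G : sgraph) (T U : {set G}) :
  0 < q -> 0 < E -> 0 < s -> #|T| = (q + 1) * (coarse_factor E q * s) ->
  (4 * E + (q + 1)) * #|U| * #|T| < 4 * E * (q + 1) * \sum_(x in T) degin x U ->
  2 * q ^ 3 * s * 2 ^ #|T| * #|T| <= #|U| ->
  exists N U' : {set G}, [/\ N \subset T, U' \subset U, complete_pair N U',
    coarse_factor E q * s + q ^ 2 * s <= #|N| & 2 * q ^ 3 * s <= #|U'|].
Proof.
move=> q0 E0 s0 cT heavy big; apply: common_neighbourhood.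
rewrite sum_degin_sym.
apply: (@leq_ltn_trans (#|U| * (coarse_factor E q * s + 2 * (q ^ 2 * s)))).
  have : 0 < q ^ 2 * s by rewrite muln_gt0 expn_gt0 q0.
  move: big; set y := _ * #|T|; move: (coarse_factor E q * s) (q ^ 2 * s) => c z yU z0.
  have : #|U| <= #|U| * z by rewrite leq_pmulr.
  by lia.
set e := \sum_(x in T) _ in heavy *.
have lt_e : (4 * E + (q + 1)) * #|U| * (coarse_factor E q * s) < 4 * E * e.
  rewrite -(@ltn_pmul2l (q + 1)) ?addn1 //; move: heavy; rewrite cT addn1; clear.
  by move: (coarse_factor E q * s) => c; lia.
rewrite -(@ltn_pmul2l (4 * E)); last by lia.
apply: leq_ltn_trans lt_e.
have -> : (4 * E + (q + 1)) * #|U| * (coarse_factor E q * s) =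
  4 * E * (#|U| * (coarse_factor E q * s)) + #|U| * ((q + 1) * coarse_factor E q * s) by lia.
rewrite mulnDr mulnDr leq_add2l.
rewrite mulnCA leq_mul2l /coarse_factor; apply/orP; right.
set z := q ^ 2; nia.
Qed.

(** The vertices of [U] send few edges to [U], which is sparse, and to [Y],
    which is small, so on average they keep at least [1 / (q + 1) + 1 / (2 E)]
    times [#|G|] neighbours in [X]: half of the surplus [1 / E] survives. *)
Lemma degree_into_big_tiles q E (G : sgraph) (X Y : {set G}) :
  let U := ~: (X :|: Y) in
  (forall v : G, (E + (q + 1)) * #|G| <= E * (q + 1) * deg v) ->
  4 * E * #|Y| <= #|G| ->
  4 * E * (\sum_(u in U) degin u U) <= #|U| * #|U| ->
  (4 * E + 2 * (q + 1)) * #|G| * #|U| <=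
    4 * E * (q + 1) * \sum_(x in X) degin x U.
Proof.
move=> U degG cY sparse; rewrite -sum_degin_sym.
have : 4 * ((E + (q + 1)) * #|G|) * #|U| <=
  4 * E * (q + 1) * (\sum_(u in U) degin u U + \sum_(u in U) degin u X + #|U| * #|Y|).
  rewrite mulnC -sum_nat_const -sum_nat_const -!big_split big_distrr /=.
  apply: leq_sum => u _.
  apply: (@leq_trans (4 * (E * (q + 1) * deg u))); first by rewrite leq_mul2l degG orbT.
  rewrite -!mulnA leq_mul2l !leq_mul2l; apply/orP; right; apply/orP; right; apply/orP; right.
  have -> : deg u = degin u (U :|: X :|: Y).
    by rewrite deg_degin_setT -setUA setUC setUCr.
  apply: leq_trans (degin_setU _ _ _) _; apply: leq_add (leq_degin _ _).
  exact: degin_setU.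
have cU : #|U| <= #|G| by apply: max_card.
have : 4 * E * #|Y| * #|U| <= #|G| * #|U| by rewrite leq_mul2r cY orbT.
have : #|U| * #|U| <= #|G| * #|U| by rewrite leq_mul2r cU orbT.
move: sparse; rewrite !mulnDr.
set e1 := \sum_(u in U) degin u U; set e2 := \sum_(u in U) _.
set n := #|G|; set y := #|Y|; set m := #|U|; move=> h1 h2 h3.
have : 4 * E * e1 + 4 * E * y * m <= 2 * (n * m) by lia.
move=> h4.
have h5 : (q + 1) * (4 * E * e1 + 4 * E * y * m) <= (q + 1) * (2 * (n * m)).
  by rewrite leq_mul2l h4 orbT.
by move: h5; clear; nia.
Qed.

(** The bookkeeping of [tiling_round]: covering [v] uncovered vertices by tiles
    of the fine scale, at the cost of breaking up [t] vertices of a coarse tile,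
    keeps the set [y] of finely tiled vertices within [k] times the progress made. *)
Lemma round_budget y k m v u t :
  y + k * (m + v) <= k * u -> t + v <= k * v -> t + v + y + k * m <= k * u.
Proof. by rewrite mulnDr; lia. Qed.

Lemma round_measure m a v b : a + v = b -> 0 < v -> b < m.+1 -> a < m.
Proof. by lia. Qed.

(** One round of the tiling: starting from coarse tiles that leave at most [u]
    vertices uncovered, pass to the fine scale and cover a further proportion
    [1 / g] of the graph, unless only boundedly many vertices remain.
    The coarse part [X] and the fine part [Y] evolve together. As long as [Y] is
    small, either the uncovered set contains a fine tile, or it is sparse and
    then sends many edges to some coarse tile, which [tile_exchange] breaks up
    with a gain. Every gain is at least [1 / k] of what is added to [Y], so [Y]
    can become large only after substantial progress. *)
Lemma tiling_round q E s : 0 < q -> 0 < E -> 0 < s -> exists M : nat,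
  forall G : sgraph,
  (forall v : G, (E + (q + 1)) * #|G| <= E * (q + 1) * deg v) ->
  forall (u : nat) (X : {set G}), tiled q (coarse_factor E q * s) X ->
  #|~: X| <= u ->
  let g := 4 * E * ((q + 1) * coarse_factor E q + 1) in
  exists Z : {set G}, tiled q s Z /\
    (#|~: Z| <= M \/ #|G| + g * #|~: Z| <= g * u).
Proof.
move=> q0 E0 s0; set C := coarse_factor E q; set k := (q + 1) * C + 1.
pose t := (q + 1) * (C * s).
pose M := q * 2 ^ (16 * E * s) * (16 * E * s) + 8 * E * (16 * E * s)
          + 2 * q ^ 3 * s * 2 ^ t * t.
exists M => G degG u X tX cX g.
have [Y [tY dXY inv]] : exists Y, [/\ tiled q s Y, [disjoint X & Y] &
    #|Y| + k * #|~: (X :|: Y)| <= k * u].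
  exists set0; rewrite setU0 cards0 add0n leq_mul2l cX orbT; split=> //.
    exact: tiled0.
  by rewrite -setI_eq0 setI0.
have [m] := ubnP #|~: (X :|: Y)|.
elim: m X Y {cX} tX tY dXY inv => // m IH X Y tX tY dXY inv cU.
have tXY : tiled q s (X :|: Y) by apply: tiled_union => //; apply: tiled_refine tX.
have [small|large] := leqP #|~: (X :|: Y)| M; first by exists (X :|: Y); auto.
(* If the fine part is large, the budget says that the round is complete. *)
have [nY|Yn] := leqP #|G| (4 * E * #|Y|).
  exists (X :|: Y); split=> //; right; rewrite /g -!mulnA.
  have : 4 * E * (#|Y| + k * #|~: (X :|: Y)|) <= 4 * E * (k * u).
    by rewrite leq_mul2l inv orbT.
  by rewrite -/C -/k; lia.
set U := ~: (X :|: Y) in inv cU large *.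
have dU (V : {set G}) : V \subset U -> [disjoint V & X] /\ [disjoint V & Y].
  by move=> /subsetP VU; split; rewrite disjoint_subset; apply/subsetP=> x /VU;
    rewrite !inE negb_or => /andP[].
have cUV (V : {set G}) : V \subset U -> #|U :\: V| + #|V| = #|U|.
  by move=> VU; rewrite cardsDS // subnK // subset_leq_card.
have [||[A [B [AU BU cA cB AB]]]|sparse] := @dense_tile q G q0 s E U s0 E0.
- by apply: leq_ltn_trans large; rewrite /M -addnA leq_addr.
- by apply: leq_trans (ltnW large); rewrite /M addnAC leq_addl.
- have ABU : A :|: B \subset U by rewrite subUset AU.
  have [dABX dABY] := dU _ ABU; have := cUV _ ABU.
  have -> : U :\: (A :|: B) = ~: (X :|: (A :|: B :|: Y)).
    by rewrite setDE -setCU; congr (~: _); rewrite -setUA (setUC Y).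
  rewrite cardU_disjoint ?complete_pair_disjoint // cA cB => EU.
  apply: (IH X (A :|: B :|: Y)) => //.
  + exact: tiledU.
  + by rewrite disjointUr dXY disjoint_sym dABX.
  + rewrite cardU_disjoint // cardU_disjoint ?complete_pair_disjoint // cA cB.
    rewrite -[s + q * s]add0n; apply: round_budget; first by rewrite EU.
    by rewrite add0n leq_pmull // /k addn1.
  + by apply: round_measure EU _ cU; rewrite addn_gt0 s0.
have heavy := degree_into_big_tiles degG (ltnW Yn) sparse.
have n0 : 0 < #|G| by apply: leq_trans (max_card (mem U)); apply: leq_ltn_trans large.
have [|A [B [X' [EX [cA cB] [AB dX] tX' heavyAB]]]] :=
  @tiled_heavy_tile q G _ X (fun x => degin x U) ((4 * E + (q + 1)) * #|U|) (4 * E * (q + 1)) tX.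
  apply: leq_trans heavy.
  have : #|X| <= #|G| by apply: max_card.
  have : 0 < #|U| by lia.
  move: #|U| #|X| #|G| n0 => a b c c0 a0 bc.
  have h : a * b <= a * c by rewrite leq_mul2l bc orbT.
  have h2 : 0 < a * c by rewrite muln_gt0 a0.
  have h3 : (4 * E + (q + 1)) * (a * b) <= (4 * E + (q + 1)) * (a * c) by rewrite leq_mul2l h orbT.
  by move: h2 h3; clear; nia.
have cAB : #|A :|: B| = t.
  by rewrite cardU_disjoint ?complete_pair_disjoint // cA cB /t; lia.
have [|N [U' [NAB U'U NU' cN cU']]] := heavy_tile_neighbourhood q0 E0 s0 cAB heavyAB.
  by rewrite cAB; apply: leq_trans (ltnW large); rewrite /M leq_addl.
have [dU'X dU'Y] := dU _ U'U.
have dABU : [disjoint A :|: B & U'].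
  by move: dU'X; rewrite EX disjointUr disjoint_sym => /andP[].
have [V [VU' cV tV]] : exists V : {set G},
    [/\ V \subset U', s <= #|V| & tiled q s (A :|: B :|: V)].
  apply: (@tile_exchange q G q0 s C A B N U') => //.
  by rewrite leq_pmull // muln_gt0.
have VU := subset_trans VU' U'U.
have [dVX dVY] := dU _ VU; have := cUV _ VU.
have -> : U :\: V = ~: (X' :|: (A :|: B :|: V :|: Y)).
  rewrite setDE -setCU EX; congr (~: _); apply/setP=> x; rewrite !inE.
  by do !case: (_ \in _).
move=> EU.
have dABV : [disjoint A :|: B & V].
  by rewrite disjoint_sym (disjointWl VU') // disjoint_sym.
move: dXY dVX; rewrite EX disjointUl disjointUr => /andP[dABY dX'Y] /andP[_ dVX'].
apply: (IH X' (A :|: B :|: V :|: Y)) => //.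
+ by apply: tiled_union; rewrite // disjointUl dABY.
+ by rewrite !disjointUr -disjointUr disjoint_sym dX disjoint_sym dVX' dX'Y.
+ rewrite cardU_disjoint; last by rewrite disjointUl dABY.
  rewrite cardU_disjoint // cAB.
  apply: round_budget; first by rewrite EU.
  by rewrite /k mulnDl mul1n leq_add2r /t mulnA leq_mul2l cV orbT.
+ by apply: round_measure EU _ cU; apply: leq_trans cV.
Qed.

(** Each round of [tiling_round] covers a fixed proportion of the vertices, so a
    bounded number of rounds suffices. Every round divides the scale by a constant;
    hence the induction on the number of rounds goes from the last scale, which
    is prescribed, to coarser ones. *)
Theorem almost_perfect_tiling q E s : 0 < q -> 0 < E -> 0 < s -> exists M : nat,
  forall G : sgraph,
  (forall v : G, (E + (q + 1)) * #|G| <= E * (q + 1) * deg v) ->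
  exists Z : {set G}, tiled q s Z /\ #|~: Z| <= M.
Proof.
move=> q0 E0 s0; pose C := coarse_factor E q; pose g := 4 * E * ((q + 1) * C + 1).
have C0 : 0 < C by rewrite /C /coarse_factor; nia.
suff rounds r : forall s, 0 < s -> exists M : nat, forall G : sgraph,
    (forall v : G, (E + (q + 1)) * #|G| <= E * (q + 1) * deg v) ->
    exists Z : {set G}, tiled q s Z /\
      (#|~: Z| <= M \/ r * #|G| + g * #|~: Z| <= g * #|G|).
  have [M HM] := rounds g.+1 s s0; exists M => G degG.
  have [Z [tZ [//|]]] := HM G degG; first by exists Z.
  move=> h; exists Z; split=> //; apply: leq_trans (max_card _) _; nia.
elim: r => [|r IH] {}s {}s0.
  (* Before the first round no vertex is covered. *)
  exists 0 => G _; exists set0; split; first exact: tiled0.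
  by right; rewrite setC0 cardsT.
have [|M1 H1] := IH (C * s); first by rewrite muln_gt0 C0.
have [M2 H2] := tiling_round q0 E0 s0.
exists (M1 + M2) => G degG.
have [X [tX HX]] := H1 G degG.
have [Z [tZ HZ]] := H2 G degG #|~: X| X tX (leqnn _).
exists Z; split=> //.
move: HZ; rewrite -/C -/g => -[|HZ]; first by left; lia.
case: HX => [HX|HX].
  by left; have g0 : 0 < g; [rewrite /g; nia|]; nia.
by right; lia.
Qed.

(** * Simple bipartite realizations by switching *)

Section Pairing.
Variables (S T : eqType) (D : nat).
Implicit Types ps : seq (S * T).

Lemma count_mem_le (U : eqType) (s t : seq U) :
  (forall y, count_mem y t <= D) -> count (mem s) t <= size s * D.
Proof.
move=> tD; elim: s => [|x s IH]; first by rewrite (@eq_count _ _ pred0) ?count_pred0.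
rewrite (@eq_count _ _ (predU (pred1 x) (mem s))); last by move=> y; rewrite /= inE.
have := count_predUI (pred1 x) (mem s) t; have := tD x; rewrite /= mulSn; lia.
Qed.

(** A pair [p] fails only if [p.2] is one of the at most [D] partners of [x], or
    [p.1] one of those of [y]; each of them occurs in at most [D] pairs. *)
Lemma switchable ps x y :
  (forall x, count_mem x (unzip1 ps) <= D) ->
  (forall y, count_mem y (unzip2 ps) <= D) ->
  2 * D ^ 2 < size ps ->
  exists2 p, p \in ps & ((x, p.2) \notin ps) && ((p.1, y) \notin ps).
Proof.
move=> D1 D2 big.
have [/hasP[p pps np]|] := boolP (has (fun p => ((x, p.2) \notin ps) && ((p.1, y) \notin ps)) ps).
  by exists p.
rewrite -all_predC all_count => /eqP all_bad.
have bad : size ps <= count (fun p => (x, p.2) \in ps) ps + count (fun p => (p.1, y) \in ps) ps.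
  rewrite -count_predUI; apply: leq_trans (leq_addr _ _).
  rewrite -all_bad.
  by apply: sub_count => p /=; rewrite negb_and !negbK.
have bad2 : count (fun p => (x, p.2) \in ps) ps <= D ^ 2.
  have -> : count (fun p => (x, p.2) \in ps) ps =
      count (mem [seq p.2 | p <- ps & p.1 == x]) (unzip2 ps).
    rewrite count_map; apply: eq_in_count => p pps /=.
    apply/idP/mapP => [xp|[[a b]]]; first by exists (x, p.2); rewrite // mem_filter eqxx.
    by rewrite mem_filter /= => /andP[/eqP-> ab ->].
  apply: leq_trans (count_mem_le _ D2) _.
  by rewrite size_map size_filter -mulnn leq_mul2r -(count_map fst (pred1 x)) D1 orbT.
have bad1 : count (fun p => (p.1, y) \in ps) ps <= D ^ 2.
  have -> : count (fun p => (p.1, y) \in ps) ps =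
      count (mem [seq p.1 | p <- ps & p.2 == y]) (unzip1 ps).
    rewrite count_map; apply: eq_in_count => p pps /=.
    apply/idP/mapP => [xp|[[a b]]]; first by exists (p.1, y); rewrite // mem_filter eqxx.
    by rewrite mem_filter /= => /andP[/eqP-> ab ->].
  apply: leq_trans (count_mem_le _ D1) _.
  by rewrite size_map size_filter -mulnn leq_mul2r -(count_map snd (pred1 y)) D2 orbT.
lia.
Qed.

(** A list of pairs is a bipartite multigraph, given by its edges, and a list
    without repetition a simple one. A repeated edge [(x, y)] is removed by
    switching: some edge [(x', y')] exists such that [(x, y')] and [(x', y)] are
    both new, and exchanging the ends increases the number of distinct edges. *)
Lemma simple_pairing ps :
  (forall x, count_mem x (unzip1 ps) <= D) ->
  (forall y, count_mem y (unzip2 ps) <= D) ->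
  2 * D ^ 2 < size ps ->
  exists ps', [/\ uniq ps', perm_eq (unzip1 ps') (unzip1 ps) &
    perm_eq (unzip2 ps') (unzip2 ps)].
Proof.
have [m] := ubnP (size ps - size (undup ps)).
elim: m ps => // m IH ps lt_m D1 D2 big.
have [u|nu] := boolP (uniq ps); first by exists ps.
have [[x y] [rs [Eps xyrs]]] : exists p rs, perm_eq ps (p :: rs) /\ p \in rs.
  elim: ps nu {lt_m D1 D2 big} => //= p ps IHps; rewrite negb_and negbK.
  have [pps _|_ /= /IHps[p' [rs [Eps prs]]]] := boolP (p \in ps); first by exists p, ps.
  exists p', (p :: rs); split; last by rewrite inE prs orbT.
  apply: (@perm_trans _ (p :: p' :: rs)); first by rewrite perm_cons.
  exact: permEl (perm_catCA [:: p] [:: p'] rs).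
have [[x' y'] /= p'ps /andP[n1 n2]] := switchable x y D1 D2 big.
have [ts Ers] : exists ts, perm_eq rs ((x', y') :: ts).
  exists (rem (x', y') rs); apply: perm_to_rem.
  move: p'ps; rewrite (perm_mem Eps) inE => /orP[/eqP E|//].
  by move: n1; case: E => -> ->; rewrite (perm_mem Eps) inE eqxx.
have neq : (x, y) != (x', y').
  apply/eqP=> E; move: n1; case: E => _ <-.
  by rewrite (perm_mem Eps) inE eqxx.
have {}xyrs : (x, y) \in ts.
  by move: xyrs; rewrite (perm_mem Ers) inE (negPf neq).
have {Ers} {}Eps : perm_eq ps [:: (x, y), (x', y') & ts].
  by rewrite (perm_trans Eps) // perm_cons.
have n_ts p : p \notin ps -> p \notin ts.
  by apply: contraNN => pts; rewrite (perm_mem Eps) !inE pts !orbT.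
pose ps1 := [:: (x, y'), (x', y) & ts].
have E1 : perm_eq (unzip1 ps1) (unzip1 ps) by rewrite perm_sym (perm_map fst Eps).
have E2 : perm_eq (unzip2 ps1) (unzip2 ps).
  rewrite perm_sym (perm_trans (perm_map snd Eps)) //=.
  exact: permEl (perm_catCA [:: y] [:: y'] (map snd ts)).
have [|x0|y0||ps' [u F1 F2]] := IH ps1.
- rewrite /= !inE (negPf (n_ts _ n1)) (negPf (n_ts _ n2)) !orbF.
  have -> : ((x, y') == (x', y)) = false.
    apply/eqP => -[_ E]; move: n1; rewrite E (perm_mem Eps).
    by rewrite inE eqxx.
  have Eu : size (undup ps) <= (size (undup ts)).+1.
    rewrite (perm_size (perm_undup (perm_mem Eps))) /= inE xyrs orbT.
    by case: ifP.
  have := perm_size Eps; move: Eu lt_m (size_undup ts); rewrite /=.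
  move: (size (undup ps)) (size ps) (size (undup ts)) (size ts) => a b c d.
  by clear; lia.
- exact: leq_trans (eq_leq (permP E1 _)) (D1 x0).
- exact: leq_trans (eq_leq (permP E2 _)) (D2 y0).
- - by rewrite -(size_map fst ps1) (perm_size E1) size_map.
by exists ps'; split=> //; [apply: perm_trans E1 | apply: perm_trans E2].
Qed.
End Pairing.

Lemma card_fiber1 (S : eqType) (T : finType) (E : seq (S * T)) (x : S) : uniq E ->
  #|[set w | (x, w) \in E]| = count_mem x (unzip1 E).
Proof.
move=> uE; rewrite count_map -size_filter -(size_map snd).
have u : uniq [seq p.2 | p <- E & p.1 == x].
  rewrite map_inj_in_uniq ?filter_uniq // => -[a b] [c d].
  by rewrite !mem_filter /= => /andP[/eqP-> _] /andP[/eqP-> _] ->.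
rewrite -(card_uniqP u); apply: eq_card => w; rewrite !inE.
apply/idP/mapP => [xw|[[a b]]]; first by exists (x, w); rewrite // mem_filter eqxx.
by rewrite mem_filter /= => /andP[/eqP-> ab ->].
Qed.

Lemma card_fiber2 (S : finType) (T : eqType) (E : seq (S * T)) (y : T) : uniq E ->
  #|[set w | (w, y) \in E]| = count_mem y (unzip2 E).
Proof.
move=> uE; rewrite count_map -size_filter -(size_map fst).
have u : uniq [seq p.1 | p <- E & p.2 == y].
  rewrite map_inj_in_uniq ?filter_uniq // => -[a b] [c d].
  by rewrite !mem_filter /= => /andP[/eqP-> _] /andP[/eqP-> _] ->.
rewrite -(card_uniqP u); apply: eq_card => w; rewrite !inE.
apply/idP/mapP => [xw|[[a b]]]; first by exists (w, y); rewrite // mem_filter eqxx.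
by rewrite mem_filter /= => /andP[/eqP-> ab ->].
Qed.

(** The half-edges at the vertices of [s], for prescribed degrees [f]. *)
Definition stubs (T : Type) (f : T -> nat) (s : seq T) :=
  flatten [seq nseq (f x) x | x <- s].

Lemma count_stubs (T : eqType) (f : T -> nat) (s : seq T) (x : T) : uniq s ->
  count_mem x (stubs f s) = (x \in s) * f x.
Proof.
elim: s => //= y s IH /andP[ys us]; rewrite count_cat IH // count_nseq /= inE.
by have [->|] := eqVneq x y; rewrite ?(negPf ys) ?eqxx /= ?addn0 // eq_sym => /negPf->.
Qed.

Lemma size_stubs (T : Type) (f : T -> nat) (s : seq T) :
  size (stubs f s) = sumn [seq f x | x <- s].
Proof.
by rewrite size_flatten /shape -map_comp; congr sumn; apply: eq_map => x; rewrite /= size_nseq.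
Qed.

(** * Degree sequences realized on a set of vertices *)

(** The local form of [embeds]: recording the vertex set allows realizations on
    disjoint sets to be combined. *)
Definition packs (G : sgraph) (pi : seq nat) (X : {set G}) :=
  exists e : rel G, [/\ symmetric e, subrel e (@adj G), (forall x y, e x y -> x \in X) &
    perm_eq [seq #|[set w | e x w]| | x <- enum X] pi].

Lemma packs_perm (G : sgraph) (pi pi' : seq nat) (X : {set G}) :
  perm_eq pi pi' -> packs pi X -> packs pi' X.
Proof. by move=> E [e [es ea eX eE]]; exists e; split=> //; apply: perm_trans E. Qed.

Lemma perm_of_eq (T : eqType) (s t : seq T) : s = t -> perm_eq s t.
Proof. by move=> ->. Qed.

Lemma perm_enum_setU (T : finType) (X Y : {set T}) : [disjoint X & Y] ->
  perm_eq (enum (X :|: Y)) (enum X ++ enum Y).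
Proof.
move=> dXY; apply: uniq_perm; first exact: enum_uniq.
  rewrite cat_uniq !enum_uniq andbT /=; apply/hasPn=> x; rewrite !mem_enum => xY.
  by apply/negP=> xX; move: (disjointFr dXY xX); rewrite xY.
by move=> x; rewrite mem_cat !mem_enum inE.
Qed.

Lemma packs_union (G : sgraph) (pi pi' : seq nat) (X Y : {set G}) :
  [disjoint X & Y] -> packs pi X -> packs pi' Y -> packs (pi ++ pi') (X :|: Y).
Proof.
move=> dXY [e [es ea eX eE]] [e' [es' ea' eX' eE']].
exists (fun x y => e x y || e' x y); split.
- by move=> x y; rewrite es es'.
- by move=> x y /orP[/ea|/ea'].
- by move=> x y /orP[/eX|/eX'] xX; rewrite inE xX ?orbT.
rewrite (perm_trans (perm_map _ (perm_enum_setU dXY))) // map_cat perm_cat //.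
  apply: perm_trans eE; apply: perm_of_eq; apply/eq_in_map => x.
  rewrite mem_enum => xX; apply: eq_card => y; rewrite !inE.
  by case: (boolP (e' x y)) => [/eX'|_]; rewrite ?orbF // (disjointFr dXY xX).
apply: perm_trans eE'; apply: perm_of_eq; apply/eq_in_map => x.
rewrite mem_enum => xX; apply: eq_card => y; rewrite !inE.
by case: (boolP (e x y)) => [/eX|_] //; rewrite (disjointFl dXY xX).
Qed.

Lemma packs_embeds (G : sgraph) (pi : seq nat) (X : {set G}) : packs pi X -> embeds pi G.
Proof.
case=> e [es ea eX eE]; pose V : finType := {x : G | x \in X}.
pose f (u v : V) := e (val u) (val v).
have fs : symmetric f by move=> u v; apply: es.
have fi : irreflexive f.
  by move=> u; apply/negP=> /ea; rewrite adj_irr.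
exists (SGraph fs fi); split; last by exists val; split; [apply: val_inj | move=> x y /ea].
apply: perm_trans eE; rewrite /realizes.
have -> : [seq @deg (SGraph fs fi) v | v : V] = [seq #|[set w | e x w]| | x <- map val (enum V)].
  rewrite -map_comp; apply: eq_map => v /=; rewrite /deg -(card_imset _ val_inj).
  apply: eq_card => w; rewrite !inE; apply/imsetP/idP => [[u]|ew].
    by rewrite inE => uv ->.
  have wX : w \in X by apply: (eX w (val v)); rewrite es.
  by exists (exist _ w wX); rewrite ?inE.
apply: perm_map; apply: uniq_perm; rewrite ?enum_uniq //.
  by rewrite map_inj_uniq ?enum_uniq //; apply: val_inj.
move=> x; rewrite mem_enum; apply/mapP/idP => [[u _ ->]|xX]; first exact: valP.
by exists (exist _ x xX); rewrite ?mem_enum.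
Qed.

(** Join the half-edges of the two classes arbitrarily, then make the multigraph
    simple with [simple_pairing]. Inside a biclique nothing else can go wrong, but
    a small positive number of edges could not always be made simple. *)
Lemma packs_biclique (G : sgraph) D (A B : {set G}) (sg ta : seq nat) :
  complete_pair A B -> #|A| = size sg -> #|B| = size ta -> sumn sg = sumn ta ->
  {in sg, forall d, d <= D} -> {in ta, forall d, d <= D} ->
  sumn sg = 0 \/ 2 * D ^ 2 < sumn sg -> packs (sg ++ ta) (A :|: B).
Proof.
move=> AB cA cB Esum sgD taD big; have dAB := complete_pair_disjoint AB.
pose f x := nth 0 sg (index x (enum A)); pose g x := nth 0 ta (index x (enum B)).
have Ef : map f (enum A) = sg.
  apply: (@eq_from_nth _ 0) => [|i]; rewrite size_map -cardE //  => iA.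
  have [x0 _] : exists x, x \in A by apply/card_gt0P; apply: leq_trans iA.
  by rewrite (nth_map x0) -?cardE // /f index_uniq ?enum_uniq -?cardE.
have Eg : map g (enum B) = ta.
  apply: (@eq_from_nth _ 0) => [|i]; rewrite size_map -cardE //  => iA.
  have [x0 _] : exists x, x \in B by apply/card_gt0P; apply: leq_trans iA.
  by rewrite (nth_map x0) -?cardE // /g index_uniq ?enum_uniq -?cardE.
have fD x : f x <= D.
  by rewrite /f; have [lt|ge] := ltnP (index x (enum A)) (size sg);
    [apply/sgD/mem_nth | rewrite nth_default].
have gD x : g x <= D.
  by rewrite /g; have [lt|ge] := ltnP (index x (enum B)) (size ta);
    [apply/taD/mem_nth | rewrite nth_default].
have sz : size (stubs f (enum A)) = size (stubs g (enum B)) by rewrite !size_stubs Ef Eg.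
have cf x := count_stubs f x (enum_uniq A).
have cg x := count_stubs g x (enum_uniq B).
have [E [uE E1 E2]] : exists E : seq (G * G), [/\ uniq E,
    perm_eq (unzip1 E) (stubs f (enum A)) & perm_eq (unzip2 E) (stubs g (enum B))].
  case: big => [sg0|big].
    have s0 : size (stubs f (enum A)) = 0 by rewrite size_stubs Ef.
    exists [::]; split=> //=; first by rewrite (size0nil s0).
    by rewrite (size0nil (etrans (esym sz) s0)).
  have [|||E] := @simple_pairing _ _ D (zip (stubs f (enum A)) (stubs g (enum B))).
  - by move=> x; rewrite unzip1_zip ?sz // cf; case: (_ \in _); rewrite ?mul1n.
  - by move=> x; rewrite unzip2_zip ?sz // cg; case: (_ \in _); rewrite ?mul1n.
  - by rewrite size1_zip ?sz // -sz size_stubs Ef.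
  by rewrite unzip1_zip ?unzip2_zip ?sz // => HE; exists E.
have inE1 p : p \in E -> p.1 \in A.
  move=> /(map_f fst); rewrite (perm_mem E1) -has_pred1 has_count cf mem_enum.
  by case: (_ \in _).
have inE2 p : p \in E -> p.2 \in B.
  move=> /(map_f snd); rewrite (perm_mem E2) -has_pred1 has_count cg mem_enum.
  by case: (_ \in _).
exists (fun x y => ((x, y) \in E) || ((y, x) \in E)); split.
- by move=> x y; rewrite orbC.
- move=> x y /orP[] xy; [|rewrite adj_sym]; apply: AB.
  + exact: inE1 xy. + exact: inE2 xy. + exact: inE1 xy. + exact: inE2 xy.
- by move=> x y /orP[/inE1|/inE2] /= h; rewrite inE h ?orbT.
rewrite (perm_trans (perm_map _ (perm_enum_setU dAB))) // map_cat perm_cat //.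
  rewrite -Ef; apply: perm_of_eq; apply/eq_in_map => x; rewrite mem_enum => xA.
  have -> : f x = count_mem x (unzip1 E) by rewrite (permP E1) cf mem_enum xA mul1n.
  rewrite -card_fiber1 //; apply: eq_card => y; rewrite !inE.
  by case: (boolP ((y, x) \in E)) => [/inE2|_]; rewrite ?orbF //= (disjointFr dAB xA).
rewrite -Eg; apply: perm_of_eq; apply/eq_in_map => x; rewrite mem_enum => xA.
have -> : g x = count_mem x (unzip2 E) by rewrite (permP E2) cg mem_enum xA mul1n.
rewrite -card_fiber2 //; apply: eq_card => y; rewrite !inE.
by case: (boolP ((x, y) \in E)) => [/inE1|_] //=; rewrite (disjointFl dAB xA).
Qed.

(** * Decomposition of degree sequences into bounded pieces *)

(** Dickson's lemma: only the first [k] of the coordinates [f i] are compared. A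
    basis [L0] for the first [k] coordinates also serves those [a] whose last
    coordinate is at least the maximum over [L0]; the others fall into finitely many slices
    with constant last coordinate, to which the induction hypothesis applies. *)
Lemma dickson (T : eqType) (f : nat -> T -> nat) (k : nat) (A : T -> Prop) :
  exists L : seq T, (forall b, b \in L -> A b) /\
    forall a, A a -> exists2 b, b \in L & forall i, i < k -> f i b <= f i a.
Proof.
elim: k A => [|k IH] A.
  have [[a Aa]|noA] := EM (exists a, A a).
    exists [:: a]; split=> [b|b _]; first by rewrite inE => /eqP->.
    by exists a; rewrite ?inE.
  by exists [::]; split=> // a Aa; case: noA; exists a.
have [L0 [L0A HL0]] := IH A.
have slices m : exists L : seq T, (forall b, b \in L -> A b) /\
    forall a, A a -> f k a < m -> exists2 b, b \in L & forall i, i < k.+1 -> f i b <= f i a.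
  elim: m => [|m [L [LA HL]]]; first by exists [::].
  have [L' [L'A HL']] := IH (fun a => A a /\ f k a = m).
  exists (L ++ L'); split=> [b|a Aa]; first by rewrite mem_cat => /orP[/LA|/L'A[]].
  rewrite ltnS leq_eqVlt => /orP[/eqP fa|lt].
    have [b bL' Hb] := HL' a (conj Aa fa); exists b; first by rewrite mem_cat bL' orbT.
    move=> i; rewrite ltnS leq_eqVlt => /orP[/eqP->|/Hb//].
    by rewrite fa (L'A b bL').2.
  by have [b bL Hb] := HL a Aa lt; exists b; rewrite // mem_cat bL.
have [L [LA HL]] := slices (\max_(b <- L0) f k b).
exists (L0 ++ L); split=> [b|a Aa]; first by rewrite mem_cat => /orP[/L0A|/LA].
have [lt|ge] := ltnP (f k a) (\max_(b <- L0) f k b).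
  by have [b bL Hb] := HL a Aa lt; exists b; rewrite // mem_cat bL orbT.
have [b bL Hb] := HL0 a Aa; exists b; first by rewrite mem_cat bL.
move=> i; rewrite ltnS leq_eqVlt => /orP[/eqP->|/Hb//].
by apply: leq_trans ge; apply: leq_bigmax_seq.
Qed.

Lemma perm_cat_of_count (T : eqType) (s t : seq T) :
  (forall x, count_mem x s <= count_mem x t) -> exists r, perm_eq t (s ++ r).
Proof.
move=> /count_subseqP[s' ss' pss']; have [r Er] := perm_to_subseq ss'.
by exists r; rewrite (perm_trans Er) // perm_cat2r perm_sym.
Qed.

(** The degrees in the two classes of a bipartite graph, that is [S] and [T] in
    this order. *)
Definition bidegree : Type := seq nat * seq nat.

(** The numerical conditions on the bidegree of a [q]-unbalanced bipartite
    graph with maximum degree at most [D]. They do not imply that such a simple graph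
    exists, but they are stable under sums and under differences in the sense of
    [balanced_decomposition]. *)
Definition balanced (q D : nat) (p : bidegree) :=
  [/\ sumn p.1 = sumn p.2, q * size p.1 <= size p.2,
      {in p.1, forall d, d <= D} & {in p.2, forall d, d <= D}].

Definition bicat (ps : seq bidegree) : bidegree :=
  (flatten (map fst ps), flatten (map snd ps)).

Lemma balanced_cat q D p r :
  balanced q D p -> balanced q D r -> balanced q D (p.1 ++ r.1, p.2 ++ r.2).
Proof.
move=> [p1 p2 p3 p4] [r1 r2 r3 r4]; split=> /=.
- by rewrite !sumn_cat p1 r1.
- by rewrite !size_cat mulnDr leq_add.
- by move=> d; rewrite mem_cat => /orP[/p3|/r3].
- by move=> d; rewrite mem_cat => /orP[/p4|/r4].
Qed.

Lemma balanced_bicat q D (ps : seq bidegree) :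
  {in ps, forall p, balanced q D p} -> balanced q D (bicat ps).
Proof.
elim: ps => [|p ps IH] bal; first by split; rewrite //= muln0.
apply: (@balanced_cat q D p (bicat ps)); first by apply: bal; rewrite mem_head.
by apply: IH => r rps; apply: bal; rewrite inE rps orbT.
Qed.

(** The balanced bidegrees form a finitely generated monoid. A bidegree is
    described by the number of occurrences of each degree in each class, together
    with the slack of the inequality [q * size p.1 <= size p.2]; recording the
    slack turns the inequality into an equation, so that removing a minimal
    element given by [dickson] leaves a balanced bidegree. *)
Lemma balanced_decomposition q D : 0 < q -> exists L : seq bidegree,
  (forall h, h \in L -> balanced q D h /\ 0 < size h.2) /\
  forall p, balanced q D p -> exists ps : seq bidegree, [/\ {subset ps <= L},
    perm_eq p.1 (bicat ps).1 & perm_eq p.2 (bicat ps).2].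
Proof.
move=> q0; pose f i (p : bidegree) :=
  if i < D.+1 then count_mem i p.1 else
  if i < 2 * D.+1 then count_mem (i - D.+1) p.2 else size p.2 - q * size p.1.
have [L [LA HL]] := dickson f (2 * D.+1).+1 (fun p : bidegree => balanced q D p /\ 0 < size p.2).
exists L; split=> // p; have [m] := ubnP (size p.2).
elim: m p => // m IH p lt_m bal.
have [p0|p0] := leqP (size p.2) 0.
  exists [::]; split=> //=.
    have [_ h _ _] := bal; rewrite (@size0nil _ p.1) //.
    by move: h p0; case: (size p.1) => //; lia.
  by rewrite (@size0nil _ p.2) //; lia.
have [h hL Hh] : exists2 h : bidegree, h \in L & forall i, i < (2 * D.+1).+1 -> f i h <= f i p.
  exact: HL (conj bal p0).
have [balh h0] : balanced q D h /\ 0 < size h.2 by apply: LA.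
have [b1 b2 b3 b4] := bal; have [c1 c2 c3 c4] := balh.
have [r1 E1] : exists r : seq nat, perm_eq p.1 (h.1 ++ r).
  apply: perm_cat_of_count => d; have [dD|Dd] := ltnP d D.+1.
    by have := Hh d; rewrite /f dD; apply; lia.
  have -> : count_mem d h.1 = 0; last by [].
  by apply/count_memPn/negP => /c3; lia.
have [r2 E2] : exists r : seq nat, perm_eq p.2 (h.2 ++ r).
  apply: perm_cat_of_count => d; have [dD|Dd] := ltnP d D.+1.
    have n1 : (D.+1 + d < D.+1) = false by lia.
    have n2 : D.+1 + d < 2 * D.+1 by lia.
    by have := Hh (D.+1 + d); rewrite /f n1 n2 addKn; apply; lia.
  have -> : count_mem d h.2 = 0; last by [].
  by apply/count_memPn/negP => /c4; lia.
have slack : size h.2 - q * size h.1 <= size p.2 - q * size p.1.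
  have n1 : (2 * D.+1 < D.+1) = false by lia.
  by have := Hh (2 * D.+1); rewrite /f n1 ltnn; apply.
have s1 : size p.1 = size h.1 + size r1 by rewrite (perm_size E1) size_cat.
have s2 : size p.2 = size h.2 + size r2 by rewrite (perm_size E2) size_cat.
have [||ps [psL F1 F2]] := IH (r1, r2) _ _.
- by move: lt_m; rewrite /= s2; lia.
- split=> /=.
  + move: b1; rewrite (perm_sumn E1) (perm_sumn E2) !sumn_cat c1.
    exact: addnI.
  + move: slack b2 c2; rewrite s1 s2 mulnDr.
    by move: (q * size h.1) (q * size r1) (size h.2) (size r2) => a b c d; lia.
  + by move=> d dr; apply: b3; rewrite (perm_mem E1) mem_cat dr orbT.
  + by move=> d dr; apply: b4; rewrite (perm_mem E2) mem_cat dr orbT.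
exists (h :: ps); split.
- by move=> r; rewrite inE => /orP[/eqP->|/psL].
- by rewrite (perm_trans E1) //= perm_cat2l.
- by rewrite (perm_trans E2) //= perm_cat2l.
Qed.

Definition rep (T : Type) (n : nat) (s : seq T) : seq T := flatten (nseq n s).

Lemma size_rep (T : Type) n (s : seq T) : size (rep n s) = n * size s.
Proof. by elim: n => //= n IH; rewrite /rep /= size_cat -/(rep n s) IH mulSn. Qed.

Lemma sumn_rep n s : sumn (rep n s) = n * sumn s.
Proof. by elim: n => //= n IH; rewrite /rep /= sumn_cat -/(rep n s) IH mulSn. Qed.

Lemma rep_add (T : Type) m n (s : seq T) : rep (m + n) s = rep m s ++ rep n s.
Proof. by rewrite /rep nseqD flatten_cat. Qed.

Lemma mem_rep (T : eqType) n (s : seq T) x : x \in rep n s -> x \in s.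
Proof. by elim: n => //= n IH; rewrite /rep /= mem_cat => /orP[|/IH]. Qed.

Lemma balanced_rep q D n p : balanced q D p -> balanced q D (rep n p.1, rep n p.2).
Proof.
move=> [p1 p2 p3 p4]; split=> /=.
- by rewrite !sumn_rep p1.
- by rewrite !size_rep mulnCA leq_mul2l p2 orbT.
- by move=> d /mem_rep/p3.
- by move=> d /mem_rep/p4.
Qed.

(** By the pigeonhole principle one of the finitely many pieces occurs [K] times
    in any large balanced bidegree. The pieces do not depend on [K]. *)
Lemma abundant_piece q D : 0 < q -> exists L : seq bidegree,
  (forall h, h \in L -> balanced q D h /\ 0 < size h.2) /\
  forall K, exists N, forall p, balanced q D p -> N < size p.1 + size p.2 ->
    exists h p', [/\ h \in L, balanced q D p', perm_eq p.1 (rep K h.1 ++ p'.1) &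
      perm_eq p.2 (rep K h.2 ++ p'.2)].
Proof.
move=> q0; have [L [LA HL]] := balanced_decomposition D q0.
exists L; split=> // K.
pose b := \max_(h <- L) (size h.1 + size h.2).
have b_max (h : bidegree) : h \in L -> size h.1 + size h.2 <= b.
  by move=> hL; apply: (leq_bigmax_seq h hL).
exists (size L * K * b) => p bal big; have [ps [psL E1 E2]] := HL p bal.
have [h hL Kh] : exists2 h, h \in L & K <= count_mem h ps.
  have [/hasP[h hL Kh]|] := boolP (has (fun h => K <= count_mem h ps) L); first by exists h.
  move=> /hasPn few; exfalso.
  have ps_size : size ps <= size L * K.
    have <- : count (mem L) ps = size ps by apply/eqP; rewrite -all_count; apply/allP.
    apply: count_mem_le => h; have [/psL/few|/count_memPn->//] := boolP (h \in ps).
    by rewrite -ltnNge => /ltnW.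
  have : size p.1 + size p.2 <= size ps * b.
    rewrite (perm_size E1) (perm_size E2) /=.
    elim: ps psL {E1 E2 few ps_size} => //= r ps IH psL.
    rewrite !size_cat mulSn addnACA leq_add //.
      by apply: b_max; apply: psL; rewrite mem_head.
    by apply: IH => x xps; apply: psL; rewrite inE xps orbT.
  have : size ps * b <= size L * K * b by rewrite leq_mul2r ps_size orbT.
  by lia.
have [ps' Eps] : exists ps', perm_eq ps (nseq K h ++ ps').
  apply: perm_cat_of_count => r; rewrite count_nseq /=.
  by have [<-|_] := eqVneq h r; rewrite ?mul1n.
have F (g : bidegree -> seq nat) :
    perm_eq (flatten (map g ps)) (rep K (g h) ++ flatten (map g ps')).
  rewrite (perm_trans (perm_flatten (perm_map g Eps))) //.
  by rewrite map_cat flatten_cat map_nseq.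
exists h, (bicat ps'); split=> //.
- apply: balanced_bicat => r rps; apply: (LA _ _).1; apply: psL.
  by rewrite (perm_mem Eps) mem_cat rps orbT.
- exact: perm_trans E1 (F fst).
- exact: perm_trans E2 (F snd).
Qed.

(** A piece with class sizes [a] and [b] fills a tile K_{s,qs} exactly if [x]
    copies are placed with their first class on the small side and [y] copies the
    other way round, because the ratio of the tile lies between [b / a >= q] and
    [a / b]. Solving the two equations gives [x] and [y] proportional to
    [q * b - a] and [b - q * a], with [s] proportional to [b ^ 2 - a ^ 2]. The
    factor [W] makes the copies of each orientation numerous. *)
Lemma two_orientations q a b W : 0 < q -> q * a <= b -> 0 < b -> 0 < W ->
  exists2 s, 0 < s & forall c, 0 < c -> exists x y,
    [/\ W <= x, y = 0 \/ W <= y, x * a + y * b = c * s & x * b + y * a = q * (c * s)].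
Proof.
move=> q0 qab b0 W0; have [ab|ba] := ltnP a b.
  exists (W * (b ^ 2 - a ^ 2)) => [|c c0]; first by rewrite muln_gt0 W0 subn_gt0 ltn_sqr.
  have aqb : a < q * b by apply: leq_trans ab _; rewrite leq_pmull.
  exists (c * W * (q * b - a)), (c * W * (b - q * a)); split.
  - by rewrite -mulnA mulnCA leq_pmulr // muln_gt0 c0 subn_gt0 aqb.
  - have [->|h] := posnP (b - q * a); first by left; rewrite muln0.
    by right; rewrite -mulnA mulnCA leq_pmulr // muln_gt0 c0.
  - have Ex : (q * b - a) * a + (b - q * a) * b = b ^ 2 - a ^ 2.
      rewrite !mulnBl -!mulnn (mulnAC q b a).
      have : a * a <= q * a * b by rewrite -mulnA mulnCA leq_mul2l ltnW // orbT.
      by have := leq_mul qab (leqnn b); lia.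
    by rewrite -2!(mulnA (c * W)) -mulnDr Ex mulnA.
  - have Ex : (q * b - a) * b + (b - q * a) * a = q * (b ^ 2 - a ^ 2).
      rewrite !mulnBl mulnBr -!mulnn (mulnC b a).
      have : a * b <= q * b * b by rewrite leq_mul2r ltnW ?orbT.
      by have := leq_mul qab (leqnn a); lia.
    by rewrite -2!(mulnA (c * W)) -mulnDr Ex; lia.
(* Here [a = b], hence [q = 1], and both orientations are equivalent. *)
have q1 : q = 1 by nia.
have Eab : a = b by nia.
exists (W * b) => [|c c0]; first by rewrite muln_gt0 W0.
exists (c * W), 0; split; [by rewrite leq_pmull|by left| |].
  by rewrite Eab; lia.
by rewrite q1; lia.
Qed.

(** Since [two_orientations] allows all multiples of its scale, the product of
    the scales serves all pieces at once. *)
Lemma common_scale (T : eqType) (L : seq T) (P : T -> nat -> Prop) :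
  (forall h, h \in L -> exists2 s, 0 < s & forall c, 0 < c -> P h (c * s)) ->
  exists2 s, 0 < s & forall h, h \in L -> forall c, 0 < c -> P h (c * s).
Proof.
elim: L => [|h L IH] HL; first by exists 1.
have [s s0 Hs] := HL h (mem_head _ _).
have [|t t0 Ht] := IH; first by move=> r rL; apply: HL; rewrite inE rL orbT.
exists (s * t); first by rewrite muln_gt0 s0.
move=> r; rewrite inE => /orP[/eqP->|rL] c c0.
  by rewrite mulnCA mulnC; apply: Hs; rewrite muln_gt0 c0.
by rewrite mulnA; apply: Ht; rewrite // muln_gt0 c0.
Qed.

(** * Packing a degree sequence into tiles *)

(** The copies of each orientation are realized together. They are either without
    edges or so numerous that [packs_biclique] applies. *)
Lemma packs_tile q D s x y (G : sgraph) (A B : {set G}) (h : bidegree) :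
  balanced q D h -> #|A| = s -> #|B| = q * s -> complete_pair A B ->
  2 * D ^ 2 < x -> y = 0 \/ 2 * D ^ 2 < y ->
  x * size h.1 + y * size h.2 = s -> x * size h.2 + y * size h.1 = q * s ->
  packs ((rep x h.1 ++ rep x h.2) ++ (rep y h.2 ++ rep y h.1)) (A :|: B).
Proof.
move=> balh cA cB AB big_x big_y Es Eqs.
have [|A1 [A2 [EA dA cA1 cA2]]] := @split_of_card _ A (x * size h.1) (y * size h.2).
  by rewrite cA.
have [|B1 [B2 [EB dB cB1 cB2]]] := @split_of_card _ B (x * size h.2) (y * size h.1).
  by rewrite cB.
have dAB := complete_pair_disjoint AB.
have [h1 _ h3 h4] := balh.
have big z : 2 * D ^ 2 < z -> z * sumn h.1 = 0 \/ 2 * D ^ 2 < z * sumn h.1.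
  move=> big_z; have [->|h0] := posnP (sumn h.1); first by left; rewrite muln0.
  by right; apply: leq_trans big_z _; rewrite leq_pmulr.
rewrite {}EA {}EB in AB dAB *.
rewrite setUACA; apply: packs_union; first exact: disjointUU.
- apply: (@packs_biclique _ D); rewrite ?size_rep ?sumn_rep ?h1 //.
  + by apply: complete_pairS AB; rewrite subsetUl.
  + by move=> d /mem_rep/h3.
  + by move=> d /mem_rep/h4.
  + by rewrite -h1; apply: big.
- apply: (@packs_biclique _ D); rewrite ?size_rep ?sumn_rep ?h1 //.
  + by apply: complete_pairS AB; rewrite subsetUr.
  + by move=> d /mem_rep/h4.
  + by move=> d /mem_rep/h3.
  + by rewrite -h1; case: big_y => [->|/big//]; left.
Qed.

(** The bidegree is packed into the tiles of [X] one by one, each filled exactly by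
    copies of an abundant piece. When the rest is too small to have an abundant piece,
    it goes into the reserved biclique [(A, B)]. The rest must remain realizable to the
    end; this is ensured by keeping more than [2 * D ^ 2] edges in it: each
    step finds [W] copies of its piece beyond those that it uses, and leaves
    them. *)
Lemma packs_into_tiling q D : 0 < q -> exists s N, 0 < s /\
  forall (G : sgraph) (A B X : {set G}) (p : bidegree),
  complete_pair A B -> N <= #|A| -> N <= #|B| -> [disjoint A :|: B & X] ->
  tiled q s X -> balanced q D p -> 2 * D ^ 2 < sumn p.1 ->
  size p.1 + size p.2 <= #|X| ->
  exists2 Y : {set G}, Y \subset A :|: B :|: X & packs (p.1 ++ p.2) Y.
Proof.
move=> q0; have [L [LA HL]] := abundant_piece D q0.
pose W := (2 * D ^ 2).+1.
have [s s0 Hs] : exists2 s, 0 < s & forall h, h \in L -> exists x y,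
    [/\ W <= x, y = 0 \/ W <= y, x * size h.1 + y * size h.2 = s &
        x * size h.2 + y * size h.1 = q * s].
  have [|s s0 Hs] := @common_scale _ L (fun h s => exists x y,
      [/\ W <= x, y = 0 \/ W <= y, x * size h.1 + y * size h.2 = s &
          x * size h.2 + y * size h.1 = q * s]).
    move=> h hL; have [[_ hq _ _] h0] := LA h hL.
    exact: two_orientations.
  by exists s => // h hL; have := Hs h hL 1 isT; rewrite mul1n.
have [N HN] := HL ((q + 1) * s + W).
exists s, N; split=> // G A B X p AB NA NB dX tX.
elim: tX p dX => [|A' B' {}X cA' cB' AB' dX' tX IH] p dX bal edges size_p.
  move: size_p edges; rewrite cards0 leqn0 addn_eq0 => /andP[/eqP/size0nil-> _] /=.
  by rewrite ltn0.
have [small|large] := leqP (size p.1 + size p.2) N.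
  have [A0 A0A cA0] := @subset_of_card _ A (size p.1) ltac:(lia).
  have [B0 B0B cB0] := @subset_of_card _ B (size p.2) ltac:(lia).
  exists (A0 :|: B0); first by apply: subset_trans (subsetUl _ _); apply: setUSS.
  have [b1 _ b3 b4] := bal.
  by apply: (@packs_biclique _ D) => //; [apply: complete_pairS AB|right].
have [h [p' [hL balp' E1 E2]]] := HN p bal large.
have [balh h0] := LA h hL.
have [x [y [Wx Wy Es Eqs]]] := Hs h hL.
have xyK : x + y <= (q + 1) * s.
  rewrite mulnDl mul1n -Eqs -Es.
  have : x <= x * size h.2 by rewrite leq_pmulr.
  have : y <= y * size h.2 by rewrite leq_pmulr.
  by lia.
have EK : (q + 1) * s + W = x + y + ((q + 1) * s + W - (x + y)) by lia.
move: E1 E2; set z := _ - (x + y) in EK *; rewrite {}EK.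
have Wz : W <= z by rewrite /z; lia.
pose r : bidegree := (rep z h.1 ++ p'.1, rep z h.2 ++ p'.2).
rewrite !rep_add -!catA -/(r.1) -/(r.2) => E1 E2.
have Er : perm_eq (((rep x h.1 ++ rep x h.2) ++ (rep y h.2 ++ rep y h.1)) ++ (r.1 ++ r.2))
    (p.1 ++ p.2).
  rewrite perm_sym (perm_trans (perm_cat E1 E2)) //.
  apply/permP=> a; rewrite !count_cat; lia.
have balr : balanced q D r.
  exact: (balanced_cat (balanced_rep z balh) balp').
have cT : #|A' :|: B'| = s + q * s.
  by rewrite cardU_disjoint ?complete_pair_disjoint // cA' cB'.
move: dX; rewrite disjointUr => /andP[dT dX].
have [||Y YX pY] := IH r dX balr.
- rewrite /r /= sumn_cat sumn_rep.
  (* A piece without edges leaves the number of edges unchanged. *)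
  have [h00|hp] := posnP (sumn h.1); last first.
    by apply: leq_trans Wz (leq_trans _ (leq_addr _ _)); rewrite leq_pmulr.
  by move: edges; rewrite (perm_sumn E1) /r /= !sumn_cat !sumn_rep h00 !muln0 !add0n.
- have := perm_size E1; have := perm_size E2; rewrite !size_cat !size_rep.
  move: size_p Es Eqs; rewrite cardU_disjoint // cT.
  move: (size r.1) (size r.2) (size p.1) (size p.2) (x * _) (x * _) (y * _) (y * _).
  by clear; lia.
exists (A' :|: B' :|: Y).
  by rewrite setUCA setUS.
apply: packs_perm Er _; apply: packs_union.
- by apply: disjointWr YX _; rewrite disjointUr disjoint_sym dT.
- exact: packs_tile balh cA' cB' AB' Wx Wy Es Eqs.
- exact: pY.
Qed.

(** * Sequences with few edges *)

Lemma sum_deg_classes (H : sgraph) (S T : {set H}) : bipartite_classes S T ->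
  \sum_(v in S) deg v = \sum_(v in T) deg v.
Proof.
move=> [ST dST bip].
have degS v : v \in S -> deg v = degin v T.
  move=> vS; apply: eq_card => w; rewrite !inE; apply/idP/andP => [vw|[]//].
  have [[]|[vT _]] // := bip v w vw.
  by rewrite (disjointFr dST vS) in vT.
have degT v : v \in T -> deg v = degin v S.
  move=> vT; apply: eq_card => w; rewrite !inE; apply/idP/andP => [vw|[]//].
  have [[vS _]|[]] // := bip v w vw.
  by rewrite (disjointFr dST vS) in vT.
by rewrite (eq_bigr _ degS) (eq_bigr _ degT) sum_degin_sym.
Qed.

(** The vertices of positive degree are few and fit into one biclique; the isolated
    ones go anywhere. *)
Lemma iso_few_edges (H G : sgraph) (S T : {set H}) (A B : {set G}) m :
  bipartite_classes S T -> \sum_(v in S) deg v <= m ->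
  complete_pair A B -> m <= #|A| -> m <= #|B| -> #|H| <= #|G| ->
  iso_to_subgraph H G.
Proof.
move=> bip edges AB mA mB HG.
pose nz (V : {set H}) := [set v in V | 0 < deg v].
have nz_card V : #|nz V| <= \sum_(v in V) deg v.
  rewrite -sum1_card [X in X <= _]big_mkcond [X in _ <= X]big_mkcond /=.
  by apply: leq_sum => v _; rewrite inE; case: (v \in V); case: (deg v).
have [A0 A0A cA0] : exists2 A0 : {set G}, A0 \subset A & #|A0| = #|nz S|.
  by apply: subset_of_card; apply: leq_trans (nz_card S) (leq_trans edges mA).
have [B0 B0B cB0] : exists2 B0 : {set G}, B0 \subset B & #|B0| = #|nz T|.
  apply: subset_of_card; apply: leq_trans (nz_card T) _.
  by rewrite -(sum_deg_classes bip) (leq_trans edges).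
have [ST dST adjST] := bip.
have dnz : [disjoint nz S & nz T].
  by apply: disjointW dST; apply/subsetP=> v; rewrite inE => /andP[].
have dAB : [disjoint A0 & B0] by apply: disjointW (complete_pair_disjoint AB).
have cU : #|~: (nz S :|: nz T)| <= #|~: (A0 :|: B0)|.
  have := cardsC (nz S :|: nz T); have := cardsC (A0 :|: B0).
  rewrite !cardU_disjoint // cA0 cB0; lia.
have [R0 R0C cR0] := subset_of_card cU.
pose hs := enum (nz S) ++ enum (nz T) ++ enum (~: (nz S :|: nz T)).
pose gs := enum A0 ++ enum B0 ++ enum R0.
have shg : size hs = size gs by rewrite !size_cat -!cardE cA0 cB0 cR0.
have inhs v : v \in hs.
  by rewrite !mem_cat !mem_enum !inE orbA orbN.
have ugs : uniq gs.
  have dR : [disjoint A0 :|: B0 & R0] by rewrite disjoint_sym disjoints_subset.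
  have := perm_uniq (perm_cat (perm_enum_setU dAB) (perm_refl (enum R0))).
  by rewrite -catA -/gs -(perm_uniq (perm_enum_setU dR)) enum_uniq => <-.
have [g0 _|noG] := pickP G; last first.
  have G0 : #|H| = 0.
    by apply/eqP; rewrite -leqn0 (leq_trans HG) // (eq_card0 noG).
  have noH (v : H) : False by have := fintype0 v G0.
  by exists (fun v => False_rect _ (noH v)); split=> v; case: (noH v).
pose f v := nth g0 gs (index v hs).
have f_inj : injective f.
  move=> u v /eqP; rewrite nth_uniq ?ugs -?shg ?index_mem ?inhs // => /eqP.
  by move=> /(congr1 (nth u hs)); rewrite !nth_index ?inhs.
have fS v : v \in nz S -> f v \in A.
  move=> vS; have iv : index v hs < #|A0|.
    by rewrite cA0 cardE /hs index_cat mem_enum vS index_mem mem_enum.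
  rewrite /f nth_cat -cardE iv; apply: (subsetP A0A).
  by rewrite -mem_enum mem_nth // -cardE.
have fT v : v \in nz T -> f v \in B.
  move=> vT; rewrite /f /hs index_cat mem_enum (disjointFl dnz vT) -cardE -cA0.
  rewrite nth_cat -cardE ltnNge leq_addr /= addKn index_cat mem_enum vT.
  have iv : index v (enum (nz T)) < #|B0| by rewrite cB0 cardE index_mem mem_enum.
  rewrite nth_cat -cardE iv; apply: (subsetP B0B).
  by rewrite -mem_enum mem_nth // -cardE.
have deg_pos u v : adj u v -> 0 < deg u.
  by move=> uv; apply/card_gt0P; exists v; rewrite inE.
exists f; split=> // u v uv.
have [u0 v0] : 0 < deg u /\ 0 < deg v.
  by split; apply: deg_pos uv || (rewrite adj_sym in uv; apply: deg_pos uv).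
have [[uS vT]|[uT vS]] := adjST u v uv.
  by apply: AB; [apply: fS | apply: fT]; rewrite inE ?uS ?vT.
by rewrite adj_sym; apply: AB; [apply: fS | apply: fT]; rewrite inE ?vS ?uT.
Qed.

(** * The embedding theorem *)

Lemma mindeg_le (G : sgraph) (v : G) : mindeg G <= deg v.
Proof.
rewrite /mindeg; have : v \in index_enum G by rewrite mem_index_enum.
elim: (index_enum G) => //= w s IH; rewrite inE big_cons => /orP[/eqP->|/IH].
  exact: geq_minl.
by apply: leq_trans; apply: geq_minr.
Qed.

(** The tiling is built at the scale [S = c * s] of which the scale [s] of
    [packs_into_tiling] is a divisor: one coarse tile is kept as the reserved biclique, the others
    are refined. The constant [M] exceeds the number of uncovered vertices plus
    the size of that tile, so the remaining tiles have room for the whole sequence. *)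
Lemma embeds_unbalanced q E D : 0 < q -> 0 < E -> exists M : nat,
  forall (pi : seq nat) (G : sgraph),
  unbalanced_seq q pi -> size pi + M = #|G| -> maxval pi <= D ->
  (E + (q + 1)) * #|G| <= E * (q + 1) * mindeg G -> embeds pi G.
Proof.
move=> q0 E0; have [s [N [s0 Hpack]]] := packs_into_tiling D q0.
pose c := N + 2 * D ^ 2 + 1; pose S := c * s.
have S0 : 0 < S by rewrite muln_gt0 s0 /c addn1.
have [M HM] := almost_perfect_tiling q0 E0 S0.
exists (M + (q + 1) * S + 1) => pi G [H [Hpi [SS [TT [bip unb]]]]] size_pi pi_D degG.
have [|Z [tZ cZ]] := HM G.
  by move=> v; apply: leq_trans degG _; rewrite leq_mul2l mindeg_le orbT.
have cZG := cardsC Z.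
case: tZ cZ cZG => [|A B X cA cB AB dX tX] cZ cZG.
  by move: cZG; rewrite cards0; lia.
have cS : c <= S by rewrite leq_pmulr.
have qS : S <= q * S by rewrite leq_pmull.
have sH : #|H| = size pi by rewrite -(perm_size Hpi) size_map -cardE.
have [few|many] := leqP (\sum_(v in SS) deg v) (2 * D ^ 2).
  exists H; split=> //.
  by apply: iso_few_edges bip few AB _ _ _; rewrite ?cA ?cB ?sH /c in cS *; lia.
pose p := ([seq deg v | v <- enum SS], [seq deg v | v <- enum TT]).
have [ST dST _] := bip.
have Ep : perm_eq (p.1 ++ p.2) pi.
  apply: perm_trans Hpi; rewrite -map_cat perm_map // perm_sym.
  apply: perm_trans (perm_enum_setU dST); rewrite ST.
  by apply: perm_of_eq; apply: eq_enum => v; rewrite !inE.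
have pi_le d : d \in pi -> d <= D.
  by move=> dpi; apply: leq_trans pi_D; apply: (leq_bigmax_seq d dpi).
have balp : balanced q D p.
  split=> /=.
  - by rewrite !sumnE !big_map !big_enum (sum_deg_classes bip).
  - by rewrite !size_map -!cardE.
  - by move=> d dp; apply: pi_le; rewrite -(perm_mem Ep) mem_cat dp.
  - by move=> d dp; apply: pi_le; rewrite -(perm_mem Ep) mem_cat dp orbT.
have [||||Y _ pY] := Hpack G A B X p AB _ _ dX (tiled_refine tX) balp.
- by rewrite cA; apply: leq_trans cS; rewrite /c -addnA leq_addr.
- by rewrite cB; apply: leq_trans qS; apply: leq_trans cS; rewrite /c -addnA leq_addr.
- by rewrite /= sumnE big_map big_enum.
- rewrite -size_cat (perm_size Ep); suff: size pi <= #|X| by [].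
  move: cZG; rewrite cardU_disjoint // cardU_disjoint ?complete_pair_disjoint // cA cB.
  move: cZ size_pi; rewrite mulnDl mul1n; move: (S) (q * S) => a b; clear; lia.
exact: packs_embeds (packs_perm Ep pY).
Qed.

Import Order.TTheory GRing.Theory Num.Theory.
Local Open Scope ring_scope.

Theorem theorem5 (R : realType) (q : nat) (hq : (1 <= q)%N)
    (eta : R) (heta : 0 < eta) :
  exists n0 : nat, forall D : nat, exists M : nat,
    forall (n : nat) (pi : seq nat) (G : sgraph),
      (n0 <= n)%N ->
      unbalanced_seq q pi ->
      (size pi + M)%N = n ->
      (maxval pi <= D)%N ->
      #|G| = n ->
      n%:R / (q + 1)%:R + eta * n%:R <= (mindeg G)%:R ->
      embeds pi G.
Proof.
(* [G] is large because it has at least [M] vertices. *)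
exists 0%N => D; pose E := Num.bound eta^-1.
have lt_E : eta^-1 < E%:R by apply: archi_boundP; rewrite invr_ge0 ltW.
have E0 : (0 < E)%N by rewrite -(ltr0n R); apply: lt_trans lt_E; rewrite invr_gt0.
(* With [1 / E <= eta] in place of [eta], clearing denominators turns the degree
   condition into one between natural numbers. *)
have [M HM] := embeds_unbalanced D hq E0.
exists M => n pi G _ unb size_pi maxD cG degG.
apply: HM => //; rewrite cG //.
have E_pos : 0 < E%:R :> R by rewrite ltr0n.
have Q_pos : 0 < (q + 1)%:R :> R by rewrite ltr0n addn1.
have le_eta : E%:R^-1 <= eta by rewrite -[eta]invrK lef_pV2 ?posrE ?invr_gt0 // ltW.
rewrite -(ler_nat R) !natrM natrD.
have -> : (E%:R + (q + 1)%:R) * n%:R =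
    E%:R * (q + 1)%:R * (n%:R / (q + 1)%:R + E%:R^-1 * n%:R) :> R.
  by field; rewrite natr1 -addn1 !gt_eqF.
rewrite ler_pM2l ?mulr_gt0 //; apply: le_trans degG.
by rewrite lerD2l ler_wpM2r // ler0n.
Qed.
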